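(* For all $\varepsilon>0$ there exists $\delta>0$ such that every triangle-free graph $G$ admits a fractional colouring $w$ such that for every $v\in V(G)$ \[ w(v)\subseteq\left[0,\ (1+\varepsilon)\max\left\{\frac{\deg(v)}{\log\deg(v)},\ \frac{\delta}{\log\delta}\right\}\right). \]
   Context: Graphs are finite and simple; $\log$ is the natural logarithm; $\deg(v)$ is the degree of $v$ in $G$. $\mathcal{I}(G)$ denotes the set of independent sets of $G$ (including $\varnothing$), and $\mu$ is Lebesgue measure on $\mathbb{R}$. A fractional colouring of $G$ is an assignment $w(I)$, for $I\in\mathcal{I}(G)$, of pairwise disjoint measurable subsets of $\mathbb{R}$ to independent sets such that $\sum_{I\in\mathcal{I}(G),\,I\ni v}\mu(w(I))\ge 1$ for all $v\in V(G)$. For a vertex $v\in V(G)$, one writes $w(v)=\bigcup_{I\in\mathcal{I}(G),\,I\ni v}w(I)$. The expression $\delta/\log\delta$ presupposes $\delta\neq 1$. For vertices with $\deg(v)\le 1$, where $\deg(v)/\log\deg(v)$ is undefined, the maximum is understood to be $\delta/\log\delta$. *)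

(* Defs.v *)
From HB Require Import structures.
From mathcomp Require Import all_boot all_order all_algebra.
From mathcomp Require Import all_classical all_reals all_analysis.

Set Implicit Arguments.
Unset Strict Implicit.
Unset Printing Implicit Defensive.

Import Order.TTheory GRing.Theory Num.Theory.

Local Open Scope classical_set_scope.
Local Open Scope ring_scope.

Record sgraph := SGraph {
  vertex :> finType;
  edge : rel vertex;
  edge_sym : symmetric edge;
  edge_irrefl : irreflexive edge
}.

Definition triangle_free (G : sgraph) : Prop :=
  forall x y z : G, ~ [/\ edge x y, edge y z & edge x z].

Definition degree (G : sgraph) (v : G) : nat := #|[set u : G | edge v u]%SET|.

Definition independent (G : sgraph) (I : {set G}) : bool :=
  [forall x in I, forall y in I, ~~ edge x y].

Definition indep_set (G : sgraph) : Type := {I : {set G} | independent I}.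

(* Lebesgue (not merely Borel) measurability: the Caratheodory sigma-algebra of
   Lebesgue outer measure, which is the domain of completed_lebesgue_measure. *)
Definition lebesgue_measurable (R : realType) (A : set R) : Prop :=
  ((wlength (@idfun R))^*%mu).-cara.-measurable A.

Definition fractional_colouring (R : realType) (G : sgraph)
    (w : indep_set G -> set R) : Prop :=
  [/\ forall I, lebesgue_measurable (w I),
      trivIset setT w
    & forall v : G,
        (1 <= \sum_(I : indep_set G | v \in val I)
                completed_lebesgue_measure (w I))%E].

Definition colour_set (R : realType) (G : sgraph)
    (w : indep_set G -> set R) (v : G) : set R :=
  \bigcup_(I in [set I : indep_set G | v \in val I]) w I.

(* In the library ln 0 = 0 and x / 0 = 0, so d / ln d would be 0 for d <= 1;
   there the expression is undefined and the maximum means delta / ln delta. *)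
Definition max_deg_log (R : realType) (d : nat) (delta : R) : R :=
  if (1 < d)%N then Num.max (d%:R / ln d%:R) (delta / ln delta)
  else delta / ln delta.

(* Main.v *)
Require Import Defs.
From HB Require Import structures.
From mathcomp Require Import all_boot all_order all_algebra.
From mathcomp Require Import all_classical all_reals all_analysis.
From mathcomp Require Import ring lra.

Set Implicit Arguments.
Unset Strict Implicit.
Unset Printing Implicit Defensive.

Import Order.TTheory GRing.Theory Num.Theory.

Local Open Scope classical_set_scope.
Local Open Scope ring_scope.

(* Sampling [I] from the hard-core model with fugacity [lam] on a triangle-free
   graph, let [Z] count the neighbours of [v] with no neighbour in [I]. Then
   [P(v \in I) >= lam / (1 + lam) * E[(1 + lam) ^ - Z]] and
   [E |N(v) `&` I| = lam / (1 + lam) * E[Z]], so with [lam] a small multiple of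
   [eps], [b ~ 1 / ln d] and [a] a power of [d] of exponent less than 1,
   [a * P(v \in I) + b * E |N(v) `&` I| >= 1] pointwise in [Z], and this holds
   in every induced subgraph.
   Colour greedily: devote time to independent sets in proportion to the
   hard-core model on the graph of vertices that still need colour. While [v]
   is among them, the inequality says that [a * (colour of v) +
   b * (colour of its neighbours)] grows at least at unit speed, and no vertex
   receives more than one unit, so [v] is finished by time [a + b * deg v],
   which is at most [(1 + eps) * d / ln d] for large [d]. *)

(** * Schedules and the sets of times they assign *)

(* A schedule [s] lists classes with durations, run consecutively from time [t];
   [place t s I] is the set of times during which [I] runs. *)
Fixpoint place (R : realType) (T : eqType) (t : R) (s : seq (T * R)) (I : T) :
    set R :=
  if s is (J, l) :: s' then
    (if J == I then `[t, t + l[%classic else set0) `|` place (t + l) s' I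
  else set0.

Section place.
Variables (R : realType) (T : eqType).
Implicit Types (s : seq (T * R)) (I J : T) (t x : R).

Lemma place_ge t s I x : all (fun i => 0 <= i.2) s -> place t s I x -> t <= x.
Proof.
elim: s t => [|[J l] s IHs] t //= /andP[l0 s0] [|/(IHs _ s0)].
  by case: ifP => // _; rewrite /= in_itv /= => /andP[].
by apply: le_trans; rewrite lerDl.
Qed.

Lemma place_lt t s I x : all (fun i => 0 <= i.2) s -> place t s I x ->
  x < t + \sum_(i <- s) i.2.
Proof.
elim: s t => [|[J l] s IHs] t //= /andP[l0 s0].
rewrite big_cons /= addrA => -[|/(IHs _ s0) //].
case: ifP => // _; rewrite /= in_itv /= => /andP[_ /lt_le_trans]; apply.
rewrite lerDl big_seq sumr_ge0// => i /(allP s0).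
by [].
Qed.

Lemma place_inj t s I J x : all (fun i => 0 <= i.2) s ->
  place t s I x -> place t s J x -> I = J.
Proof.
elim: s t => [|[K l] s IHs] t //= /andP[l0 s0].
have sep L M : (if K == L then `[t, t + l[%classic else set0) x ->
    ~ place (t + l) s M x.
  case: ifP => // _; rewrite /= in_itv /= => /andP[_ xl] /(place_ge s0).
  by rewrite leNgt xl.
move=> [Ix|Ix] [Jx|Jx].
- by move: Ix Jx; case: eqP => // <- _; case: eqP.
- by case: (sep _ _ Ix Jx).
- by case: (sep _ _ Jx Ix).
- exact: IHs Ix Jx.
Qed.

Lemma place_sum_gt0 t s I x : all (fun i => 0 <= i.2) s -> place t s I x ->
  0 < \sum_(i <- s | i.1 == I) i.2.
Proof.
elim: s t => [|[K l] s IHs] t //= /andP[l0 s0]; rewrite big_cons /=.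
have s'0 : 0 <= \sum_(i <- s | i.1 == I) i.2.
  by rewrite big_seq_cond sumr_ge0// => i /andP[/(allP s0)].
case: ifP => _ [] //=.
- rewrite in_itv /= => /andP[tx xl]; rewrite ltr_pwDl//.
  by rewrite -(ltrDl t); exact: le_lt_trans xl.
- by move/(IHs _ s0) => s'gt0; rewrite ltr_wpDl.
- exact: IHs.
Qed.

Lemma place_cat t s1 s2 I :
  place t (s1 ++ s2) I =
  place t s1 I `|` place (t + \sum_(i <- s1) i.2) s2 I.
Proof.
elim: s1 t => [|[K l] s IHs] t /=; first by rewrite big_nil addr0 set0U.
by rewrite big_cons /= IHs setUA addrA.
Qed.

Lemma measurable_place t s I : measurable (place t s I).
Proof.
elim: s t => [|[K l] s IHs] t /=; first exact: measurable0.
by apply: measurableU => //; case: ifP.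
Qed.

Lemma lebesgue_measure_place t s I : all (fun i => 0 <= i.2) s ->
  (lebesgue_measure (place t s I) = (\sum_(i <- s | i.1 == I) i.2)%:E)%E.
Proof.
elim: s t => [|[K l] s IHs] t /=; first by rewrite big_nil measure0.
move=> /andP[l0 s0]; rewrite big_cons /=.
rewrite measureU/=; last 3 first.
- by case: ifP.
- exact: measurable_place.
- apply/seteqP; split => // x [] /=; case: ifP => //= _.
  by rewrite in_itv /= => /andP[_ xl] /(place_ge s0); rewrite leNgt xl.
rewrite IHs//; case: ifP => _; last by rewrite measure0 add0e.
rewrite lebesgue_measure_itv /= lte_fin ltrDl [in RHS]EFinD; congr (_ + _)%E.
case: ltgtP l0 => // [l0 _|<- //].
by rewrite -EFinB addrAC subrr add0r.
Qed.

End place.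

Lemma sum_place_lengths (R : realType) (T : finType) (s : seq (T * R))
    (Q : pred T) :
  \sum_(I | Q I) \sum_(i <- s | i.1 == I) i.2 = \sum_(i <- s | Q i.1) i.2.
Proof.
rewrite (exchange_big_dep (fun i => Q i.1)) /=; last by move=> I i QI /eqP ->.
apply: eq_bigr => i Qi; rewrite (big_pred1 i.1)// => I /=.
by rewrite eq_sym; case: eqP => [->|]; rewrite ?Qi ?andbF.
Qed.

(** * Greedy scheduling from local occupancy *)

(* [r] is the demand still to be met. Run the distribution of the support of
   [r] until a first vertex of it is satisfied; this shrinks the support. *)
Lemma greedy_schedule (R : realType) (V T : finType) (mem : T -> {set V})
    (e : rel V) (a b : V -> R) :
  (forall v, 0 <= a v) -> (forall v, 0 <= b v) ->
  (forall H : {set V}, H != finset.set0 -> exists p : T -> R,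
    let P v := \sum_(I | v \in mem I) p I in
    [/\ forall I, 0 <= p I, \sum_I p I = 1,
        forall I, p I != 0 -> mem I \subset H &
        forall v, v \in H ->
          0 < P v /\ 1 <= a v * P v + b v * \sum_(u | e v u) P u]) ->
  forall r : V -> R, (forall v, 0 <= r v) ->
  exists s : seq (T * R),
    [/\ all (fun i => 0 <= i.2) s,
        forall v, \sum_(i <- s | v \in mem i.1) i.2 = r v &
        forall t x I v, place t s I x -> v \in mem I ->
          x < t + (a v * r v + b v * \sum_(u | e v u) r u)].
Proof.
move=> a0 b0 hyp r r0.
have [n] := ubnP #|[set v | r v != 0]|%SET.
elim: n r r0 => // n IHn r r0 rn.
have [/eqP H0|H0] := boolP ([set v | r v != 0] == finset.set0)%SET.
  exists [::]; split => // v; rewrite big_nil.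
  by apply/esym/eqP; move/setP: H0 => /(_ v); rewrite !inE => /negbFE.
have [p /=] := hyp _ H0.
set P := fun v => \sum_(I | v \in mem I) p I.
move=> [p0 p1 pH pP].
have P0 v : 0 <= P v by rewrite sumr_ge0.
have /set0Pn[v0 v0H] := H0.
(* [f v] is the time at which [v] would be satisfied; [v1] comes first, at time [tau]. *)
pose f v := r v / P v.
case: (@arg_minP _ _ _ v0 (fun v => v \in [set v | r v != 0]%SET) f v0H).
move=> v1 v1H v1min.
have PoutH v : r v = 0 -> P v = 0.
  move=> rv0; rewrite /P big1// => I vI; apply/eqP/negPn/negP.
  by move=> /pH/fintype.subsetP /(_ _ vI); rewrite inE rv0 eqxx.
set tau := f v1 in v1min.
have tau_gt0 : 0 < tau.
  rewrite divr_gt0 //; last by have [] := pP _ v1H.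
  by rewrite lt_def r0 andbT; move: v1H; rewrite inE.
pose r' v := r v - tau * P v.
have r'0 v : 0 <= r' v.
  rewrite subr_ge0; have [rv0|rv0] := eqVneq (r v) 0.
    by rewrite PoutH// mulr0.
  have vH : v \in [set v | r v != 0]%SET by rewrite inE.
  rewrite -ler_pdivlMr ?v1min//; exact: (pP _ vH).1.
have r'n : (#|[set v | r' v != 0%R]%SET| < n)%N.
  rewrite -ltnS; apply: leq_trans rn; rewrite ltnS; apply: proper_card.
  apply/properP; split.
    apply/fintype.subsetP => v; rewrite !inE => r'v.
    apply: contraNneq r'v => rv0.
    by rewrite /r' rv0 (PoutH _ rv0) mulr0 subr0.
  exists v1 => //; rewrite inE negbK /r' /tau /f divfK ?subrr//.
  by rewrite gt_eqF//; exact: (pP _ v1H).1.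
have [s' [s'0 s'r s't]] := IHn _ r'0 r'n.
pose s1 := [seq (J, tau * p J) | J <- index_enum T].
have s10 : all (fun i => 0 <= i.2) s1.
  by apply/allP => _ /mapP[I _ ->] /=; rewrite mulr_ge0// ltW.
have s1tau : \sum_(i <- s1) i.2 = tau.
  by rewrite big_map /= -mulr_sumr p1 mulr1.
exists (s1 ++ s'); split.
- by rewrite all_cat s10.
- by move=> v; rewrite big_cat /= s'r big_map /= -mulr_sumr /r' addrC subrK.
move=> t x I v; rewrite place_cat s1tau => xI vI.
(* A running class contains no vertex without demand: in [s1] because classes lie in the support of
   [r], in [s'] because such a vertex receives total time 0 there. *)
have vH : v \in [set v | r v != 0]%SET.
  rewrite inE; apply/eqP => rv0.
  case: xI => [/(place_sum_gt0 s10)|/(place_sum_gt0 s'0)].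
    rewrite big_map /= big_pred1_eq.
    suff -> : p I = 0 by rewrite mulr0 ltxx.
    apply/eqP/negPn/negP => /pH/fintype.subsetP /(_ _ vI).
    by rewrite inE rv0 eqxx.
  apply/negP; rewrite -leNgt.
  have r'v : r' v <= 0 by rewrite /r' rv0 (PoutH _ rv0) mulr0 subr0.
  apply: le_trans r'v; rewrite -s'r [leLHS]big_mkcond [leRHS]big_mkcond /=.
  rewrite [leLHS]big_seq [leRHS]big_seq.
  apply: ler_sum => i /(allP s'0) i0; case: eqP => [->|_].
    by rewrite vI.
  by case: ifP.
have [_ Pv1] := pP _ vH.
(* The deadline is linear in the demand. Running [s1] for time [tau] lowers it by at least [tau], so
   the bound for [s'] started at [t + tau] stays within the one for [r]. *)
have gammaE : a v * r v + b v * \sum_(u | e v u) r u =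
   a v * r' v + b v * \sum_(u | e v u) r' u +
   tau * (a v * P v + b v * \sum_(u | e v u) P u).
  by rewrite /r' sumrB -mulr_sumr; ring.
have tauP : tau <= tau * (a v * P v + b v * \sum_(u | e v u) P u).
  by rewrite ler_peMr// ltW.
rewrite gammaE addrCA addrC.
case: xI => [/(place_lt s10)|/s't/(_ vI)].
  rewrite s1tau => /lt_le_trans; apply.
  have : 0 <= a v * r' v + b v * \sum_(u | e v u) r' u.
    by rewrite addr_ge0// mulr_ge0// sumr_ge0.
  lra.
move=> /lt_le_trans; apply; lra.
Qed.

(** * The hard-core model on triangle-free graphs *)

Lemma disjointP (T : finType) (A B : {pred T}) :
  reflect (forall x, x \in A -> x \notin B) [disjoint A & B].
Proof. by rewrite disjoint_subset; exact: fintype.subsetP. Qed.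

(** Expand a product over all [i] with factor [x + 1] in [U] and [0 + 1] outside: a subset meeting
    the complement of [U] contributes 0. *)
Lemma sum_subset_expr (R : comNzRingType) (T : finType) (x : R) (U : {set T}) :
  \sum_(S : {set T} | S \subset U) x ^+ #|S| = (1 + x) ^+ #|U|.
Proof.
transitivity (\prod_(i : T) ((if i \in U then x else 0) + 1)).
  rewrite bigA_distr [LHS]big_mkcond; apply: eq_bigr => S _.
  case: ifPn => [SU|/fintype.subsetPn[i iS iU]].
    rewrite -prodr_const [LHS]big_mkcond; apply: eq_bigr => i _.
    by case: ifP => // /(fintype.subsetP SU) ->.
  by rewrite (bigD1 i)//= iS (negbTE iU) mul0r.
rewrite -prodr_const [RHS]big_mkcond; apply: eq_bigr => i _.
by case: ifP; rewrite ?add0r // addrC.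
Qed.

Definition neighbours (G : sgraph) (v : G) : {set G} := [set u | edge v u]%SET.

(** Unnormalised hard-core weight on the subgraph induced by [H], set to 0 elsewhere so that sums
    may run over all sets. *)
Definition hard_core (R : realType) (G : sgraph) (lam : R)
    (H I : {set G}) : R :=
  if independent I && (I \subset H) then lam ^+ #|I| else 0.

Lemma independentP (G : sgraph) (I : {set G}) :
  reflect {in I &, forall x y, ~~ edge x y} (independent I).
Proof.
apply: (iffP forall_inP) => [h x y xI yI|h x xI].
  by have /forall_inP := h _ xI; apply.
by apply/forall_inP => y yI; exact: h.
Qed.

Section hard_core.
Variables (R : realType) (G : sgraph) (lam : R) (H : {set G}).
Hypothesis lam_gt0 : 0 < lam.
Local Notation W := (hard_core lam H).
Local Notation N := (@neighbours G).

Lemma hard_core_ge0 I : 0 <= W I.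
Proof. by rewrite /hard_core; case: ifP => // _; rewrite exprn_ge0// ltW. Qed.

Lemma independent_setU1 v (I : {set G}) :
  independent (v |: I)%SET = independent I && [disjoint N v & I].
Proof.
apply/independentP/andP => [h|[/independentP h /disjointP vI] x y].
  split.
    by apply/independentP => x y xI yI; rewrite h// !inE (xI, yI) orbT.
  apply/disjointP => u; rewrite inE => vu; apply/negP => uI.
  by have := h v u; rewrite !inE eqxx uI orbT vu => /(_ isT isT).
have vN u : u \in I -> ~~ edge v u.
  by move=> uI; apply: contraL uI => vu; apply: vI; rewrite inE.
rewrite !inE => /predU1P[->|xI] /predU1P[->|yI].
- by rewrite edge_irrefl.
- exact: vN.
- by rewrite edge_sym vN.
- exact: h.
Qed.

(* Resampling at [v]: adding [v] multiplies the weight of an independent set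
   avoiding [N[v]] by [lam]. *)
Lemma hard_core_mem v : v \in H ->
  (1 + lam) * \sum_(I : {set G} | v \in I) W I =
  lam * \sum_(I : {set G} | [disjoint N v & I]) W I.
Proof.
move=> vH.
have vE : \sum_(I : {set G} | v \in I) W I =
    lam * \sum_(I : {set G} | (v \notin I) && [disjoint N v & I]) W I.
  rewrite (reindex_onto (fun I => v |: I)%SET (fun I => I :\ v)%SET) /=;
    last first.
    by move=> I vI; rewrite finset.setD1K.
  rewrite mulr_sumr big_mkcond [RHS]big_mkcond /=; apply: eq_bigr => I _.
  rewrite setU11 /=; case: (boolP (v \in I)) => vI /=.
    by case: eqP => // /setP/(_ v); rewrite !inE eqxx vI.
  rewrite finset.setU1K// eqxx /hard_core independent_setU1.
  case: (boolP [disjoint N v & I]) => dj; last by rewrite andbF.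
  rewrite andbT finset.subUset finset.sub1set vH /=.
  by case: ifP => _; rewrite ?mulr0// cardsU1 vI exprS.
rewrite mulrDl mul1r {1}vE -mulrDr; congr (_ * _).
rewrite [RHS](bigID (fun I : {set G} => v \in I)) /= addrC; congr (_ + _).
  by apply: eq_bigl => I; rewrite andbC.
rewrite [RHS]big_mkcondl/= [LHS]big_mkcond [RHS]big_mkcond.
apply: eq_bigr => I _.
case: ifP => // vI; case: ifPn => // dj; rewrite /hard_core.
case: ifP => // /andP[/independentP h _]; exfalso; move/negP: dj; apply.
apply/disjointP => u; rewrite inE => vu; apply/negP => uI.
by have := h _ _ vI uI; rewrite vu.
Qed.

(** Its cardinality is [Z], counted within [H]; a neighbour belonging to an independent [I] inside
    [H] counts as well. *)
Definition free_nbrs v (I : {set G}) : {set G} :=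
  [set u in N v | (u \in H) && [disjoint N u & I]]%SET.

(** Sum the resampling identity over the neighbours in [H]; those outside [H] give 0 on both
    sides. *)
Lemma hard_core_nbrs v :
  (1 + lam) * \sum_(u | edge v u) \sum_(I : {set G} | u \in I) W I =
  lam * \sum_(I : {set G}) #|free_nbrs v I|%:R * W I.
Proof.
rewrite [in RHS](eq_bigr (fun I => \sum_(u in free_nbrs v I) W I)); last first.
  by move=> I _; rewrite sumr_const mulr_natl.
rewrite (exchange_big_dep [pred u | edge v u]) /=; last first.
  by move=> I u _; rewrite !inE => /andP[].
rewrite !mulr_sumr; apply: eq_bigr => u vu; have [uH|uH] := boolP (u \in H).
  rewrite hard_core_mem//; congr (_ * _); apply: eq_bigl => I.
  by rewrite !inE vu uH.
rewrite !big1 ?mulr0// => I; rewrite ?inE ?(negbTE uH) ?andbF//.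
move=> uI; rewrite /hard_core; case: ifP => //.
move=> /andP[_ /fintype.subsetP/(_ u uI)].
by rewrite (negbTE uH).
Qed.

Hypothesis Gtf : triangle_free G.

Lemma neighbours_indep v x y : x \in N v -> y \in N v -> ~~ edge x y.
Proof.
rewrite !inE => vx vy; apply/negP => xy.
apply: (Gtf (x := v) (y := x) (z := y)).
by split.
Qed.

(** By triangle-freeness a neighbour of [v] has no neighbour in [N v], so [I :&: N v] does not
    affect which neighbours are free. *)
Lemma free_nbrs_setD v (I : {set G}) :
  free_nbrs v (I :\: N v) = free_nbrs v I.
Proof.
apply/setP => u; rewrite !inE; case vu : (edge v u) => //=; congr (_ && _).
apply/disjointP/disjointP => dj x ux.
  apply: contra (dj _ ux) => xI; rewrite !inE xI andbT.
  apply: contraL ux => vx; rewrite inE.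
  by apply: (@neighbours_indep v); rewrite inE.
by rewrite inE negb_and (dj _ ux) orbT.
Qed.

(* Given [J = I :\: N v], the set [I :&: N v] is a subset of [free_nbrs v J]. *)
Lemma hard_core_disjoint v :
  \sum_(I : {set G}) W I / (1 + lam) ^+ #|free_nbrs v I| <=
  \sum_(I : {set G} | [disjoint N v & I]) W I.
Proof.
have lam1 : 0 < 1 + lam by rewrite ltr_wpDl.
rewrite (partition_big (fun I : {set G} => I :\: N v)%SET
  (fun J : {set G} => [disjoint N v & J]%B)) /=; last first.
  by move=> I _; apply/disjointP => u uN; rewrite inE uN.
apply: ler_sum => J dj.
rewrite (eq_bigr (fun I => W I / (1 + lam) ^+ #|free_nbrs v J|)); last first.
  by move=> I /eqP <-; rewrite free_nbrs_setD.
rewrite -mulr_suml ler_pdivrMr ?exprn_gt0//.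
have [WJ|WJ] := boolP (independent J && (J \subset H)); last first.
  rewrite big1 ?mulr_ge0 ?hard_core_ge0 ?exprn_ge0 ?(ltW lam1)// => I /eqP IJ.
  rewrite /hard_core; case: ifP => // /andP[/independentP hI IH].
  have JI : J \subset I by rewrite -IJ finset.subsetDl.
  exfalso; move/negP: WJ; apply; rewrite (fintype.subset_trans JI IH) andbT.
  apply/independentP => x y /(fintype.subsetP JI) xI /(fintype.subsetP JI).
  exact: hI.
rewrite [X in X * _]/hard_core WJ -sum_subset_expr mulr_sumr.
apply: le_trans (_ : \sum_(I : {set G} | (I :\: N v)%SET == J)
    (if I :&: N v \subset free_nbrs v J
     then lam ^+ #|J| * lam ^+ #|I :&: N v| else 0)%SET <= _).
  apply: ler_sum => I /eqP IJ; rewrite /hard_core.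
  case: ifP => [/andP[/independentP hI IH]|_]; last first.
    by case: ifP => // _; rewrite mulr_ge0// exprn_ge0// ltW.
  rewrite -IJ -exprD addnC cardsID ifT//.
  apply/fintype.subsetP => u; rewrite !inE => /andP[uI ->] /=.
  rewrite (fintype.subsetP IH)//=; apply/disjointP => x ux; apply/negP.
  rewrite inE => /andP[_ xI].
  by have := hI _ _ uI xI; move: ux; rewrite inE => ->.
rewrite -big_mkcondr /=.
rewrite (reindex_onto (fun S : {set G} => S :|: J)%SET
  (fun I : {set G} => I :&: N v)%SET) /=; last first.
  by move=> I /andP[/eqP <- _]; rewrite finset.setID.
(* Sets [S] not recovered from [S :|: J] could only add nonnegative terms on the right. *)
rewrite [leRHS](bigID (fun S : {set G} =>
  ((S :|: J) :\: N v == J)%SET && ((S :|: J) :&: N v == S)%SET)) /=.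
rewrite -[leLHS]addr0 lerD//; last first.
  by rewrite sumr_ge0// => S _; rewrite mulr_ge0// exprn_ge0// ltW.
rewrite le_eqVlt; apply/orP; left; apply/eqP.
rewrite big_mkcond [RHS]big_mkcond; apply: eq_bigr => S _.
case: (((S :|: J) :\: N v)%SET == J) => /=; rewrite ?andbF//.
case: eqP => [->|] /=; rewrite ?andbT ?andbF//.
Qed.

(** After multiplying by [1 + lam], both occupancy terms equal or dominate sums over [I], and the
    hypothesis at [m = #|free_nbrs v I|] gives the comparison term by term. *)
Lemma hard_core_local_occupancy (a b : R) v : v \in H ->
  0 <= a -> 0 <= b ->
  (forall m : nat, 1 + lam <= lam * (a / (1 + lam) ^+ m + b * m%:R)) ->
  \sum_(I : {set G}) W I <=
  a * \sum_(I : {set G} | v \in I) W I +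
  b * \sum_(u | edge v u) \sum_(I : {set G} | u \in I) W I.
Proof.
move=> vH a0 b0 hab; have lam1 : 0 < 1 + lam by rewrite ltr_wpDl.
rewrite -(ler_pM2l lam1) mulrDr ![(1 + lam) * (_ * _)]mulrCA.
rewrite hard_core_mem// hard_core_nbrs.
apply: le_trans (_ :
    a * (lam * \sum_(I : {set G}) W I / (1 + lam) ^+ #|free_nbrs v I|) +
    b * (lam * \sum_(I : {set G}) #|free_nbrs v I|%:R * W I) <= _); last first.
  by rewrite lerD2r ler_wpM2l// ler_wpM2l ?(ltW lam_gt0)// hard_core_disjoint.
rewrite !mulr_sumr -big_split /=; apply: ler_sum => I _.
have := hab #|free_nbrs v I|; move/(ler_wpM2r (hard_core_ge0 I)).
move/le_trans; apply; rewrite le_eqVlt; apply/orP; left; apply/eqP; ring.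
Qed.

End hard_core.

(** * Choice of the parameters and their asymptotics *)

Section parameters.
Variables (R : realType) (lam : R).
Hypothesis lam_gt0 : 0 < lam.

Let lam1 : 0 < 1 + lam.
Proof. exact: addr_gt0. Qed.

Let lam2 : 0 < 1 + 2 * lam.
Proof. by apply: addr_gt0 => //; exact: mulr_gt0. Qed.

(** This exponent is below 1, and [m < theta / lam * ln x] is exactly the range where the [beta]
    term alone falls short of [1 + lam]. *)
Definition theta : R := (1 + lam) / (1 + 2 * lam).
Definition alpha (x : R) : R := (1 + lam) / lam * x `^ theta.
Definition beta (x : R) : R := (1 + 2 * lam) / ln x.

Lemma alpha_ge0 x : 0 <= alpha x.
Proof. by rewrite mulr_ge0 ?powR_ge0// divr_ge0 ?ltW. Qed.

Lemma beta_ge0 x : 1 < x -> 0 <= beta x.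
Proof. by move=> x1; rewrite divr_ge0 ?ln_ge0 ?ltW. Qed.

(* Either the second term alone suffices, or [m < theta / lam * ln x] and then
   [(1 + lam) ^ m <= exp (lam * m) <= x ^ theta]. *)
Lemma alpha_beta_occupancy x (m : nat) : 1 < x ->
  1 + lam <= lam * (alpha x / (1 + lam) ^+ m + beta x * m%:R).
Proof.
move=> x1; have x0 : 0 < x by lra.
have L0 := ln_gt0 x1.
rewrite mulrDr; have [h|h] := leP (1 + lam) (lam * (beta x * m%:R)).
  rewrite -[leLHS]add0r lerD// mulr_ge0 ?(ltW lam_gt0)//.
  by rewrite divr_ge0 ?alpha_ge0 ?exprn_ge0 ?(ltW lam1).
have hm : lam * m%:R <= theta * ln x.
  have -> : lam * m%:R = lam * (beta x * m%:R) * (ln x / (1 + 2 * lam)).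
    by rewrite /beta; field; rewrite !gt_eqF.
  have -> : theta * ln x = (1 + lam) * (ln x / (1 + 2 * lam)).
    by rewrite /theta; ring.
  by rewrite ler_wpM2r ?(ltW h)// divr_ge0 ?ltW.
have hp : (1 + lam) ^+ m <= x `^ theta.
  rewrite /powR gt_eqF//; apply: le_trans (_ : expR (lam * m%:R) <= _).
    rewrite mulrC expRM_natl lerXn2r ?nnegrE ?expR_ge0 ?(ltW lam1)//.
    exact: expR_ge1Dx.
  by rewrite ler_expR.
rewrite -[leLHS]addr0 lerD//; last first.
  by rewrite mulr_ge0 ?(ltW lam_gt0)// mulr_ge0 ?beta_ge0.
rewrite mulrA ler_pdivlMr ?exprn_gt0//.
have -> : lam * alpha x = (1 + lam) * x `^ theta.
  by rewrite /alpha; field; rewrite gt_eqF.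
by rewrite ler_wpM2l ?(ltW lam1).
Qed.

(** Write [x] as [x ^ theta * x ^ k * x ^ k]: for large [x] one factor [x ^ k] reaches the constant
    [K], and the other always exceeds [k * ln x]. *)
Lemma alpha_small : exists x0 : R, forall x, 1 < x -> x0 <= x ->
  alpha x <= 2 * lam * (x / ln x).
Proof.
pose k := (1 - theta) / 2.
have k0 : 0 < k.
  rewrite divr_gt0// subr_gt0 /theta ltr_pdivrMr// mul1r.
  by rewrite ltrD2l ltr_pMl// ltr1n.
pose K := (1 + lam) / lam / (2 * lam * k).
have K0 : 0 < K.
  by apply: divr_gt0; [exact: divr_gt0|apply: mulr_gt0 => //; exact: mulr_gt0].
exists (K `^ k^-1) => x x1 xK.
have x0 : 0 < x by lra.
have L0 := ln_gt0 x1.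
have Kx : K <= x `^ k.
  have := ge0_ler_powR (ltW k0) _ _ xK.
  rewrite -powRrM mulVf ?gt_eqF// powRr1 ?(ltW K0)//; apply.
    by rewrite nnegrE powR_ge0.
  by rewrite nnegrE ltW.
have Lx : k * ln x <= x `^ k by rewrite -ln_powR ltW// ln_sublinear// powR_gt0.
have xE : x `^ theta * (x `^ k * x `^ k) = x.
  rewrite -!powRD ?(gt_eqF x0) ?implybT//.
  have -> : theta + (k + k) = 1 by rewrite /k; field.
  by rewrite powRr1// ltW.
have t0 := powR_ge0 x theta.
rewrite mulrA ler_pdivlMr//.
have -> : alpha x * ln x = 2 * lam * x `^ theta * (K * (k * ln x)).
  by rewrite /alpha /K; field; rewrite !gt_eqF.
have -> : 2 * lam * x = 2 * lam * x `^ theta * (x `^ k * x `^ k).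
  by rewrite -[RHS]mulrA xE.
rewrite ler_wpM2l// ?mulr_ge0 ?(ltW lam_gt0)//.
by apply: ler_pM => //; [exact: ltW|apply: mulr_ge0; exact: ltW].
Qed.

(** Of the final factor, [1 + 2 * lam] pays for [beta x * d] and [2 * lam] for [alpha x]. *)
Lemma alpha_beta_le x0 d x : 1 < x ->
  (forall y, 1 < y -> x0 <= y -> alpha y <= 2 * lam * (y / ln y)) ->
  x0 <= x -> d <= x -> alpha x + beta x * d <= (1 + 4 * lam) * (x / ln x).
Proof.
move=> x1 h xx0 dx; have L0 := ln_gt0 x1.
have := h _ x1 xx0.
have : beta x * d <= (1 + 2 * lam) * (x / ln x).
  rewrite [leRHS]mulrA [leRHS]mulrAC -/(beta x).
  by rewrite ler_wpM2l// beta_ge0.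
lra.
Qed.

End parameters.

(** * From local occupancy to the fractional colouring *)

Lemma sum_indep_set (R : realType) (G : sgraph) (lam : R) (H : {set G})
    (Q : pred {set G}) :
  \sum_(I : indep_set G | Q (val I)) hard_core lam H (val I) =
  \sum_(I : {set G} | Q I) hard_core lam H I.
Proof.
rewrite -(big_sub_cond (@independent G) Q (hard_core lam H)).
rewrite big_mkcondl [LHS]big_mkcond [RHS]big_mkcond; apply: eq_bigr => I _.
case: ifP => // _; case: ifPn => // nI.
by rewrite /hard_core -[independent I]/(I \in @independent G) (negbTE nI).
Qed.

Lemma fractional_colouring_of_local_occupancy (R : realType) (G : sgraph)
    (lam : R) (a b : G -> R) :
  0 < lam -> triangle_free G -> (forall v, 0 <= a v) -> (forall v, 0 <= b v) ->
  (forall v (m : nat),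
     1 + lam <= lam * (a v / (1 + lam) ^+ m + b v * m%:R)) ->
  exists w : indep_set G -> set R, fractional_colouring w /\
    forall v, colour_set w v `<=` `[0, a v + b v * (degree v)%:R[%classic.
Proof.
move=> lam_gt0 Gtf a0 b0 hab.
have lam1 : 0 < 1 + lam by lra.
have occ (H : {set G}) : H != finset.set0 -> exists p : indep_set G -> R,
    let P v := \sum_(I : indep_set G | v \in val I) p I in
    [/\ forall I, 0 <= p I, \sum_(I : indep_set G) p I = 1,
        forall I, p I != 0 -> val I \subset H &
        forall v, v \in H ->
          0 < P v /\ 1 <= a v * P v + b v * \sum_(u | edge v u) P u].
  move=> _; pose Z := \sum_(I : {set G}) hard_core lam H I.
  have W0 : hard_core lam H finset.set0 = 1.
    rewrite /hard_core cards0 expr0 finset.sub0set andbT ifT//.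
    by apply/independentP => x y; rewrite inE.
  have Z_gt0 : 0 < Z.
    rewrite /Z (bigD1 finset.set0)//= W0 ltr_pwDl// sumr_ge0// => I _.
    exact: hard_core_ge0.
  exists (fun I => hard_core lam H (val I) / Z) => P.
  have PE v : P v = (\sum_(I : {set G} | v \in I) hard_core lam H I) / Z.
    by rewrite /P -mulr_suml (sum_indep_set lam H (fun I => v \in I)).
  split.
  - by move=> I; rewrite divr_ge0 ?hard_core_ge0// ltW.
  - by rewrite -mulr_suml (sum_indep_set lam H xpredT) divff// gt_eqF.
  - move=> I; rewrite /hard_core; case: ifP => [/andP[_ ->]//|_].
    by rewrite mul0r eqxx.
  move=> v vH; split.
    (* By the resampling identity, positivity follows from the weight 1 of the empty set, which
       avoids [N v]. *)
    rewrite PE divr_gt0// -(pmulr_rgt0 _ lam1) hard_core_mem// pmulr_rgt0//.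
    rewrite (bigD1 finset.set0) /=; last first.
      by apply/disjointP => u _; rewrite inE.
    by rewrite W0 ltr_pwDl// sumr_ge0// => I _; exact: hard_core_ge0.
  under eq_bigr do rewrite PE.
  rewrite PE -mulr_suml !mulrA -mulrDl ler_pdivlMr// mul1r.
  exact: hard_core_local_occupancy.
have r0 (v : G) : 0 <= 1 :> R by [].
have [s [s0 s1 st]] := greedy_schedule a0 b0 occ r0.
exists (place 0 s); split; first split.
- by move=> I; apply: sub_caratheodory; exact: measurable_place.
- by move=> I J _ _ [x [xI xJ]]; exact: place_inj s0 xI xJ.
- move=> v.
  rewrite (eq_bigr (fun I => (\sum_(i <- s | i.1 == I) i.2)%:E)); last first.
    (* The completed measure is convertible to [lebesgue_measure], so the Borel computation
       applies. *)
    by move=> I _; exact: lebesgue_measure_place.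
  rewrite sumEFin lee_fin -(s1 v).
  by rewrite le_eqVlt -(sum_place_lengths s (fun I => v \in val I)) eqxx.
- move=> v x [I /= vI xI]; rewrite /= in_itv /= (place_ge s0 xI) /=.
  have := st _ _ _ _ xI vI; rewrite add0r mulr1 sumr_const /degree.
  by congr (_ < _ + _ * _ %:R); apply: eq_card => u; rewrite !inE.
Qed.

Theorem theorem2 (R : realType) (eps : R) (eps_gt0 : 0 < eps) :
  exists delta : R, [/\ 0 < delta, delta != 1 &
    forall G : sgraph, triangle_free G ->
      exists w : indep_set G -> set R,
        fractional_colouring w /\
        forall v : G,
          colour_set w v `<=`
            `[0, (1 + eps) * max_deg_log (degree v) delta[%classic].
Proof.
(* [4 * lam = eps] matches the total loss in [alpha_beta_le]. *)
pose lam := eps / 4.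
have lam_gt0 : 0 < lam by rewrite divr_gt0.
have epsE : eps = 4 * lam by rewrite /lam; field.
have [x0 hx0] := alpha_small lam_gt0.
(* The 2 ensures [1 < delta]; [x0] is the threshold for [alpha]. *)
pose delta := Num.max 2 x0.
have d1 : 1 < delta by rewrite lt_max ltr1n.
exists delta; split; first by lra.
  by rewrite gt_eqF.
(* Evaluating [alpha] and [beta] at [D v] keeps the argument above the threshold for vertices of
   small degree. *)
move=> G Gtf; pose D (v : G) := Num.max (degree v)%:R delta.
have D1 v : 1 < D v by rewrite lt_max d1 orbT.
have [w [wc wD]] := fractional_colouring_of_local_occupancy lam_gt0 Gtf
  (fun v => alpha_ge0 lam_gt0 (D v)) (fun v => beta_ge0 lam_gt0 (D1 v))
  (fun v m => alpha_beta_occupancy lam_gt0 m (D1 v)).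
exists w; split => // v x /wD; rewrite /= !in_itv /= => /andP[->] /= xlt.
apply: lt_le_trans xlt _.
apply: le_trans (_ : (1 + eps) * (D v / ln (D v)) <= _).
  rewrite epsE; apply: (alpha_beta_le lam_gt0 (D1 v) hx0).
    by rewrite !le_max lexx !orbT.
  by rewrite le_max lexx.
rewrite ler_wpM2l//; first by lra.
(* If the degree is at most [delta], both branches are at least [delta / ln delta]; otherwise it
   exceeds 1 and the first branch applies. *)
rewrite /max_deg_log /D; have [dd|dd] := leP (degree v)%:R delta.
  by case: ifP => _ //; rewrite le_max lexx orbT.
rewrite ifT ?le_max ?lexx//.
by rewrite -(ltr1n R); lra.
Qed.
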